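(* Let $r\ge 2$ be an integer and let $\gamma,\varepsilon,\eta\in(0,1)$ be real numbers. There exists a constant $C>0$ such that for every integer $n\ge 1$ and all $p\in(C\log(n)/n,1)$, asymptotically almost surely every subhypergraph $H\subseteq H_{n,p,r}$ of order $m=|V(H)|$ satisfying (i) $m\ge \gamma n$, (ii) $m\equiv 0 \pmod r$, and (iii) $\delta_{r-1}(H)\ge (\tfrac12+\varepsilon)pm$, contains a $k$-factor for every positive integer $k\le \varepsilon(1-\eta)mp$.
   Context: For integers $n\ge1$, $r\ge 2$ and $p\in[0,1]$, $\mathbf{H}(n,p,r)$ is the probability space of $r$-uniform hypergraphs on vertex set $[n]$ in which each $r$-subset of $[n]$ is a hyperedge independently with probability $p$; $H_{n,p,r}$ denotes a random hypergraph sampled from it. A property holds asymptotically almost surely (a.a.s.) if its probability tends to $1$ as $n\to\infty$. A subhypergraph $H\subseteq H_{n,p,r}$ has vertex set $V(H)\subseteq[n]$ and hyperedge set a subset of the hyperedges of $H_{n,p,r}$ contained in $V(H)$ (so $H$ is $r$-uniform). For $W\subseteq V(H)$, $\deg_H(W)$ is the number of hyperedges of $H$ containing $W$, and the minimum $(r-1)$-degree $\delta_{r-1}(H)$ is the minimum of $\deg_H(W)$ over all $(r-1)$-subsets $W\subseteq V(H)$. A $k$-factor of $H$ is a spanning subhypergraph of $H$ (same vertex set) in which every vertex has degree exactly $k$. *)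

(* Defs.v *)
From HB Require Import structures.
From mathcomp Require Import all_boot all_order all_algebra.
From mathcomp Require Import all_classical all_reals all_analysis.
Set Implicit Arguments.
Unset Strict Implicit.
Unset Printing Implicit Defensive.
Import Order.TTheory GRing.Theory Num.Theory.
Import numFieldNormedType.Exports.
Local Open Scope ring_scope.

Record hypergraph (r : nat) (T : finType) := Hypergraph {
  hg_pair : {set T} * {set {set T}};
  hg_uniform :
    [forall e in hg_pair.2, (e \subset hg_pair.1) && (#|e| == r)] }.

HB.instance Definition _ (r : nat) (T : finType) :=
  [isSub for @hg_pair r T].
HB.instance Definition _ (r : nat) (T : finType) :=
  [Finite of hypergraph r T by <:].

Definition vertices (r : nat) (T : finType) (H : hypergraph r T) : {set T} :=
  (hg_pair H).1.

Definition hyperedges (r : nat) (T : finType) (H : hypergraph r T) :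
    {set {set T}} :=
  (hg_pair H).2.

Definition subhypergraph (r : nat) (T : finType) (H K : hypergraph r T) : bool :=
  (vertices H \subset vertices K) && (hyperedges H \subset hyperedges K).

Definition hdeg (r : nat) (T : finType) (H : hypergraph r T) (W : {set T}) : nat :=
  #|[set e in hyperedges H | W \subset e]|.

(* Every degree is at most the number of hyperedges, so the initial value does
   not affect the minimum unless H has fewer than r - 1 vertices. *)
Definition min_codegree (r : nat) (T : finType) (H : hypergraph r T) : nat :=
  \big[minn/#|hyperedges H|]_(W : {set T} |
     (W \subset vertices H) && (#|W| == r - 1)%N) hdeg H W.

Definition is_factor (r : nat) (T : finType) (k : nat) (F H : hypergraph r T) : Prop :=
  [/\ subhypergraph F H,
      vertices F = vertices H &
      forall v : T, v \in vertices F -> hdeg F [set v] = k].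

(* Meaningful for K with vertex set [set: 'I_n], where every r-subset of 'I_n is
   a potential hyperedge; hnpr_prob only sums over such K. *)
Definition hnpr_weight (R : realType) (n r : nat) (p : R)
    (K : hypergraph r 'I_n) : R :=
  \prod_(e : {set 'I_n} | #|e| == r)
    (if e \in hyperedges K then p else 1 - p).

Definition hnpr_prob (R : realType) (n r : nat) (p : R)
    (A : set (hypergraph r 'I_n)) : R :=
  \sum_(K : hypergraph r 'I_n | (vertices K == [set: 'I_n]%SET) && (K \in A))
    hnpr_weight p K.

Lemma hnpr_probT (R : realType) (n r : nat) (p : R) :
  hnpr_prob p [set: hypergraph r 'I_n]%classic = 1.
Proof.
rewrite /hnpr_prob.
under eq_bigl do rewrite mem_setT andbT.
pose F (e : {set 'I_n}) : R := if #|e| == r then p else 0.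
pose G (e : {set 'I_n}) : R := if #|e| == r then 1 - p else 1.
have -> : 1 = \prod_(e : {set 'I_n}) (F e + G e).
  rewrite big1 // => e _; rewrite /F /G.
  by case: ifP => _; [rewrite addrC subrK | rewrite add0r].
rewrite bigA_distr.
rewrite [RHS](bigID (fun J : {set {set 'I_n}} => [forall e in J, #|e| == r])) /=.
rewrite [X in _ = _ + X]big1 ?addr0; last first.
  move=> J /forallPn[e]; rewrite negb_imply => /andP[eJ er].
  by rewrite (bigD1 e) //= eJ /F (negbTE er) mul0r.
have unif (J : {set {set 'I_n}}) : [forall e in J, #|e| == r] =
    [forall e in ([set: 'I_n]%SET, J).2,
      (e \subset ([set: 'I_n]%SET, J).1) && (#|e| == r)].
  by apply: eq_forallb => e /=; rewrite finset.subsetT.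
have K0 : hypergraph r 'I_n.
  apply: (@Hypergraph r _ (finset.set0, finset.set0)).
  by apply/forall_inP => e; rewrite inE.
pose h (J : {set {set 'I_n}}) : hypergraph r 'I_n :=
  insubd K0 ([set: 'I_n]%SET, J).
rewrite (reindex_onto h (@hyperedges r _)) /=; last first.
  move=> K /eqP VK; apply: val_inj; rewrite /h insubdK -?VK; last first.
    by case: K {VK} => K HK; exact: HK.
  by rewrite /vertices /hyperedges -surjective_pairing.
apply: eq_big => [J|J].
- apply/idP/idP => [/andP[/eqP VJ /eqP <-]|].
    apply/forall_inP => e eJ.
    by have /forall_inP/(_ e eJ)/andP[] := hg_uniform (h J).
  rewrite unif => HJ.
  by rewrite /vertices /hyperedges /h [hg_pair _]insubdK //= !eqxx.
move=> /andP[_ /eqP EJ]; rewrite /hnpr_weight EJ big_mkcond.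
apply: eq_bigr => e _; rewrite /F /G.
have [//|er] := eqVneq #|e| r.
have [eJ|//] := boolP (e \in J).
move: eJ; rewrite -EJ => eJ.
by have /forall_inP/(_ e eJ)/andP[_] := hg_uniform (h J); rewrite (negbTE er).
Qed.

Definition aas (R : realType) (r : nat) (p : nat -> R)
    (A : forall n : nat, set (hypergraph r 'I_n)) : Prop :=
  ((fun n : nat => hnpr_prob (p n) (A n)) @ \oo --> (1 : R))%classic.

(* Main.v *)
Require Import Defs.
From mathcomp Require Import all_boot all_order all_algebra all_fingroup.
From mathcomp Require Import all_classical all_reals all_analysis.
From mathcomp Require Import ring lra zify.
Import Order.TTheory GRing.Theory Num.Theory.
Import numFieldNormedType.Exports.
Set Implicit Arguments.
Unset Strict Implicit.
Unset Printing Implicit Defensive.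
Local Open Scope classical_set_scope.
Local Open Scope ring_scope.

(** A Chernoff bound and a union bound show that a.a.s. the random hypergraph G is [spread]:
for every family X of (r-1)-sets and every vertex set Z, at most
p|X||Z| + d p n max(|X|,|Z|) edges have the form W + z with W in X and z in Z.

The rest is deterministic.  Let H be a subhypergraph of such a G, with m = rM vertices.  A
random labelling of V(H) by r classes of size M gives every (r-1)-set at least
(1/2 + eps - o(1)) p M neighbours in each class.  Permuting the first class at random against
the others then gives r-1 systems, indexed by a cyclic shift, of M disjoint (r-1)-sets missing
the last class, such that the bipartite graph between each system and the last class has
minimum degree (1/2 + eps - o(1)) p M on both sides.  By spreadness each of these graphs
satisfies the Ore-Ryser condition for a k'-factor whenever k' <= (2 eps - o(1)) p M.  The r-1
graphs use disjoint sets of edges of H, and 2(r-1) >= r, so the union of such factors reaches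
every k <= eps (1 - eta) p m.

Concentration for random permutations comes from switching.  Let F(t) be the number of
permutations s with at most t points (i, s i) in a set D of density mu per row.  Composing
with the transposition that forces s i = u for a chosen (i, u) in D changes the count by at
most 2, and double counting gives mu F(t) <= (t + 2) F(t + 2); iterating this below
(1 - d/2) mu gives an exponential lower tail.

The Ore-Ryser theorem is proved by deletion: in an edge-minimal graph satisfying the condition,
every edge at a vertex a crosses a tight pair of sets; uncrossing produces one tight pair
containing all neighbours of a, and removing a from it forces deg a <= k. *)

(** * Random permutations *)

Definition hits (T : finType) (D : {set T * T}) (s : {perm T}) : nat :=
  #|[set i | (i, s i) \in D]%SET|.

Definition few_hits (T : finType) (D : {set T * T}) (t : nat) : {set {perm T}} :=
  [set s | (hits D s <= t)%N]%SET.

(** Only [i] and the preimage of [u] change their images, so at most these two points become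
    hits. *)
Lemma hits_mul_tperm (T : finType) (D : {set T * T}) (s : {perm T}) (i u : T) :
  (hits D (s * tperm (s i) u)%g <= (hits D s).+2)%N.
Proof.
rewrite /hits.
apply: (@leq_trans #|[set i; (s^-1)%g u]%SET :|: [set j | (j, s j) \in D]%SET|).
  apply/subset_leq_card/fintype.subsetP => j.
  rewrite !finset.inE permM.
  have [->|ji] := eqVneq j i; first by [].
  have [->|ju] := eqVneq j ((s^-1)%g u); first by rewrite orbT.
  rewrite tpermD //; first by rewrite (inj_eq perm_inj) eq_sym.
  by apply: contra_neq ju => ->; rewrite permK.
apply: leq_trans (leq_card_setU _ _) _.
rewrite -[X in (_ <= X)%N]add2n leq_add2r.
by rewrite cards2; case: (_ != _).
Qed.

(** Double counting of [G]: a permutation with at most [t.+2] hits occurs in it at most [t.+2]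
    times, while forcing [s i = u] sends each pair from [D] and [few_hits D t] into [G]. *)
Lemma few_hits_switch (T : finType) (D : {set T * T}) (t : nat) :
  (#|D| * #|few_hits D t| <= #|T| * (t.+2 * #|few_hits D t.+2|))%N.
Proof.
pose G := [set x : (T * T) * {perm T} |
  [&& x.1 \in D, x.2 x.1.1 == x.1.2 & x.2 \in few_hits D t.+2]]%SET.
have cardG : (#|G| <= t.+2 * #|few_hits D t.+2|)%N.
  rewrite -sum1_card (eq_bigl (fun x : (T * T) * {perm T} => predT x.1 &&
      ((x.2 \in few_hits D t.+2) && ((x.1 \in D) && (x.2 x.1.1 == x.1.2)))));
    last by move=> x; rewrite !finset.inE /=;
      do ![case: (_ \in _); rewrite ?andbF //=]; rewrite andbC.
  rewrite -(pair_big_dep predT (fun (d : T * T) (s : {perm T}) =>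
     (s \in few_hits D t.+2) && ((d \in D) && (s d.1 == d.2))) (fun _ _ => 1%N)) /=.
  rewrite (exchange_big_dep (fun s => s \in few_hits D t.+2)) /=; last first.
    by move=> d s _ /andP[].
  rewrite mulnC -sum_nat_const; apply: leq_sum => s sF.
  have : (hits D s <= t.+2)%N by move: sF; rewrite finset.inE.
  apply: leq_trans; rewrite sum1_card /hits.
  rewrite -(card_imset _ (f := fun i => (i, s i))); last by move=> i j [].
  apply/subset_leq_card/fintype.subsetP => -[i u]; rewrite -topredE /=.
  move=> /and3P[_ iuD /eqP siu]; apply/imsetP; exists i; last by rewrite siu.
  by rewrite finset.inE siu.
rewrite -cardsX.
apply: leq_trans (leq_mul (leqnn _) cardG).
rewrite -cardsT -cardsX.
(* Recording the old value [s i] makes the switch invertible and accounts for the factor [#|T|]. *)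
pose f (x : (T * T) * {perm T}) : T * ((T * T) * {perm T}) :=
  (x.2 x.1.1, (x.1, (x.2 * tperm (x.2 x.1.1) x.1.2)%g)).
rewrite -(card_imset _ (f := f)); last first.
  move=> [d s] [d' s']; rewrite /f /= => -[e1 e2].
  by rewrite -e1 -e2 => /mulIg ->.
apply/subset_leq_card/fintype.subsetP => _ /imsetP[[[i u] s] + ->].
rewrite finset.inE /= => /andP[dD sF].
rewrite /f !finset.inE /= dD permM tpermL eqxx /=.
apply: leq_trans (hits_mul_tperm _ _ _ _) _.
by move: sF; rewrite finset.inE.
Qed.

Lemma few_hits_iter (R : realType) (T : finType) (D : {set T * T}) (mu rho : R)
    (t h : nat) :
  0 < mu -> mu * #|T|%:R <= #|D|%:R -> (0 < #|T|)%N ->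
  (t + h.*2)%:R <= rho * mu ->
  #|few_hits D t|%:R <= rho ^+ h * #|few_hits D (t + h.*2)|%:R :> R.
Proof.
move=> mu0 muD T0; elim: h => [|h IH] hle.
  by rewrite expr0 mul1r addn0.
have rho0 : 0 <= rho.
  by rewrite -(pmulr_lge0 _ mu0) (le_trans _ hle) ?ler0n.
apply: le_trans (IH _) _.
  by apply: le_trans hle; rewrite ler_nat leq_add2l leq_double.
rewrite exprSr -mulrA ler_wpM2l ?exprn_ge0 //.
have := few_hits_switch D (t + h.*2).
rewrite -!addnS -doubleS; set F := #|few_hits D _|; set G := #|few_hits D _|.
rewrite -(ler_nat R) !natrM => sw.
rewrite -(ler_pM2l mu0) -(ler_pM2r (x := #|T|%:R)) ?ltr0n //.
apply: (@le_trans _ _ (#|D|%:R * F%:R)).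
  by rewrite mulrAC ler_wpM2r.
apply: le_trans sw _.
rewrite [X in _ <= X]mulrC ler_wpM2l // mulrA ler_wpM2r // mulrC.
exact: hle.
Qed.

Lemma few_hits_tail (R : realType) (T : finType) (D : {set T * T}) (mu dl : R) :
  0 < mu -> 0 < dl < 1 -> mu * #|T|%:R <= #|D|%:R -> (0 < #|T|)%N ->
  #|[set s : {perm T} | (hits D s)%:R < (1 - dl) * mu]%SET|%:R <=
    2 * expR (- (dl ^+ 2 * mu / 8)) * #|{perm T}|%:R :> R.
Proof.
move=> mu0 /andP[dl0 dl1] muD T0.
(* These choices give [t + 2 * h <= (1 - dl / 2) * mu], so the iteration runs with
   [rho = 1 - dl / 2]. *)
pose t := Num.truncn ((1 - dl) * mu).
pose h := Num.truncn (dl * mu / 4).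
have tle : t%:R <= (1 - dl) * mu by rewrite truncn_le mulr_ge0 // ?subr_ge0 ltW.
have hle : h%:R <= dl * mu / 4 by rewrite truncn_le !mulr_ge0 // ltW.
have hge : dl * mu / 4 < h.+1%:R := truncnS_gt _.
apply: (@le_trans _ _ #|few_hits D t|%:R).
  rewrite ler_nat; apply/subset_leq_card/fintype.subsetP => s.
  rewrite !finset.inE => lt; rewrite truncn_ge_nat ?(ltW lt) //.
  by rewrite mulr_ge0 // ?subr_ge0 ltW.
apply: le_trans (few_hits_iter (rho := 1 - dl / 2) (h := h) mu0 muD T0 _) _.
  rewrite natrD -muln2 natrM; move: tle hle; clearbody t h.
  move: (t%:R : R) (h%:R : R) => x y.
  lra.
have rho0 : 0 <= 1 - dl / 2 by lra.
apply: ler_pM; rewrite ?exprn_ge0 ?ler0n //; last first.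
  by rewrite ler_nat max_card.
apply: (@le_trans _ _ (expR (- (dl / 2)) ^+ h)).
  rewrite lerXn2r ?nnegrE ?expR_ge0 //.
  by apply: le_trans (expR_ge1Dx _); lra.
(* Rounding [h] down costs at most one factor [expR (dl / 2)], which is the 2 in the bound. *)
have e2 : expR (dl / 2) <= 2 :> R.
  have : 1 - dl / 2 <= expR (- (dl / 2)) by apply: le_trans (expR_ge1Dx _); lra.
  have p0 := expR_gt0 (dl / 2).
  have := expRxMexpNx_1 (dl / 2).
  by nra.
rewrite -expRM_natl.
apply: (@le_trans _ _ (expR (dl / 2) * expR (- (dl ^+ 2 * mu / 8)))).
  rewrite -expRD ler_expR.
  have : dl / 2 * (dl * mu / 4) <= dl / 2 * h.+1%:R by rewrite ler_wpM2l ?(ltW hge) //; lra.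
  rewrite -[h.+1%:R]natr1; move: (h%:R : R) => x; lra.
by rewrite ler_wpM2r ?expR_ge0.
Qed.

Lemma perm_many_hits (R : realType) (T I : finType) (D : I -> {set T * T})
    (mu dl : R) :
  0 < mu -> 0 < dl < 1 -> (0 < #|T|)%N ->
  (forall i, mu * #|T|%:R <= #|D i|%:R) ->
  #|I|%:R * (2 * expR (- (dl ^+ 2 * mu / 8))) < 1 ->
  exists s : {perm T}, forall i, (1 - dl) * mu <= (hits (D i) s)%:R.
Proof.
move=> mu0 dl01 T0 muD small.
pose bad i := [set s : {perm T} | (hits (D i) s)%:R < (1 - dl) * mu]%SET.
apply: contrapT => /forallNP none.
have cover : (#|{perm T}| <= \sum_i #|bad i|)%N.
  rewrite -sum1_card; under [X in (_ <= X)%N]eq_bigr do rewrite -sum1_card.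
  rewrite (exchange_big_dep predT) //=; apply: leq_sum => s _.
  rewrite sum1_card; apply/card_gt0P.
  have /existsNP[i /negP] := none s; rewrite -ltNge => lt.
  have sbad : s \in bad i by rewrite finset.inE.
  by exists i.
move: cover; apply/negP; rewrite -ltnNge -(ltr_nat R) natr_sum.
apply: le_lt_trans (ler_sum _ (fun i _ => few_hits_tail mu0 dl01 (muD i) T0)) _.
rewrite sumr_const -[_ *+ #|_|]mulr_natl mulrA -[X in _ < X]mul1r ltr_pM2r //.
by rewrite ltr0n; apply/card_gt0P; exists 1%g.
Qed.

(** * Factors of bipartite graphs *)


Section BipartiteFactor.
Variables (A B : finType) (k : nat).
Implicit Types (E : {set A * B}) (X : {set A}) (Y : {set B}).

Definition edges_between E X Y : nat :=
  #|[set e in E | (e.1 \in X) && (e.2 \in Y)]%SET|.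

Lemma edges_betweenE E X Y :
  edges_between E X Y = (\sum_(e in E) ((e.1 \in X) && (e.2 \in Y)))%N.
Proof.
by rewrite /edges_between -sum1dep_card big_mkcondr.
Qed.

(** The Ore-Ryser condition, additive because subtraction on [nat] truncates, and boolean so that a
    minimal set satisfying it can be taken. *)
Definition demand E : bool :=
  [forall X : {set A}, forall Y : {set B}, (k * (#|X| + #|Y|) <= k * #|A| + edges_between E X Y)%N].

Definition tight E X Y : bool :=
  (k * (#|X| + #|Y|) == k * #|A| + edges_between E X Y)%N.

Lemma edges_between_uncross E X X' Y Y' :
  (edges_between E (X :&: X')%SET (Y :|: Y')%SET +
   edges_between E (X :|: X')%SET (Y :&: Y')%SET <=
   edges_between E X Y + edges_between E X' Y')%N.
Proof.
rewrite !edges_betweenE -!big_split /=; apply: leq_sum => -[a b] _ /=.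
by rewrite !finset.inE; do !case: (_ \in _).
Qed.

(** Cardinalities are modular and edge counts submodular, so the demands of the two uncrossed pairs
    add up with no slack left in either. *)
Lemma tight_uncross E X X' Y Y' : demand E -> tight E X Y -> tight E X' Y' ->
  tight E (X :&: X')%SET (Y :|: Y')%SET.
Proof.
move=> dE /eqP t1 /eqP t2; apply/eqP.
have /forallP/(_ (X :&: X')%SET)/forallP/(_ (Y :|: Y')%SET) := dE.
have /forallP/(_ (X :|: X')%SET)/forallP/(_ (Y :&: Y')%SET) := dE.
have uc := edges_between_uncross E X X' Y Y'.
have cX := cardsUI X X'; have cY := cardsUI Y Y'.
move: t1 t2 uc cX cY.
move: #|(X :|: X')%SET| #|(X :&: X')%SET| #|(Y :|: Y')%SET| #|(Y :&: Y')%SET|.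
move: #|X| #|X'| #|Y| #|Y'| => x x' y y' xu xi yu yi.
move: (edges_between E _ _) (edges_between E _ _) (edges_between E _ _)
  (edges_between E _ _) => e1 e2 e3 e4.
nia.
Qed.

Lemma minimal_demand_deg E (a : A) : demand E ->
  (forall e, e \in E -> ~~ demand (E :\ e)%SET) ->
  (#|[set b | (a, b) \in E]%SET| <= k)%N.
Proof.
move=> dE minE; pose N := [set b | (a, b) \in E]%SET; rewrite -/N.
have cut b : b \in N -> exists Z : {set A} * {set B},
    [/\ tight E Z.1 Z.2, a \in Z.1 & b \in Z.2].
  (* Deleting [(a, b)] lowers an edge count by at most one, so a pair violating the condition
     afterwards was tight and contains both ends. *)
  rewrite finset.inE => abE.
  have /forallPn[X /forallPn[Y]] := minE _ abE; rewrite -ltnNge => lt.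
  exists (X, Y) => /=.
  have /forallP/(_ X)/forallP/(_ Y) := dE.
  have eb : edges_between E X Y =
      (((a \in X) && (b \in Y)) + edges_between (E :\ (a, b))%SET X Y)%N.
    rewrite !edges_betweenE (big_setD1 (a, b)) //=.
  move: lt; rewrite /tight eb; case: (a \in X); case: (b \in Y) => /=;
    try (rewrite add0n => lt /(leq_trans lt); by rewrite ltnn).
  move=> lt le; split => //; rewrite eqn_leq le /=.
  by rewrite add1n addnS.
have [->|] := eqVneq N finset.set0; first by rewrite cards0.
case/set0Pn => b0 b0N.
have {cut} [Z [tZ aZ NZ]] : exists Z : {set A} * {set B},
    [/\ tight E Z.1 Z.2, a \in Z.1 & N \subset Z.2].
  suff : forall s : seq B, {subset s <= N} -> s != [::] ->
      exists Z : {set A} * {set B},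
        [/\ tight E Z.1 Z.2, a \in Z.1 & {subset s <= Z.2}].
    move=> /(_ (enum N)) []; first by move=> b; rewrite mem_enum.
      by apply: contraTneq b0N => E0; rewrite -mem_enum E0.
    move=> Z [tZ aZ NZ]; exists Z; split => //.
    by apply/fintype.subsetP => b bN; apply: NZ; rewrite mem_enum.
  elim=> [//|b s IH] sub _.
  have [Z [tZ aZ bZ]] := cut b (sub b (mem_head _ _)).
  have [->|s0] := eqVneq s [::].
    by exists Z; split => // c; rewrite mem_seq1 => /eqP ->.
  have [|//|Z' [tZ' aZ' sZ']] := IH.
    by move=> c cs; apply: sub; rewrite in_cons cs orbT.
  exists (Z.1 :&: Z'.1, Z.2 :|: Z'.2)%SET; split => /=.
  - exact: tight_uncross.
  - by rewrite finset.inE aZ.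
  - move=> c; rewrite in_cons finset.inE => /orP[/eqP ->|/sZ' ->].
      by rewrite bZ.
    by rewrite orbT.
(* Removing [a] lowers the left side by [k] and the edge count by exactly [#|N|]; as [Z] was tight,
   [#|N| <= k]. *)
have /forallP/(_ (Z.1 :\ a)%SET)/forallP/(_ Z.2) := dE.
move/eqP: tZ; rewrite (cardsD1 a Z.1) aZ /=.
suff -> : edges_between E Z.1 Z.2 =
    (#|N| + edges_between E (Z.1 :\ a)%SET Z.2)%N by nia.
rewrite -(card_imset N (f := fun b => (a, b))); last by move=> b c [].
rewrite /edges_between -(cardsID [set e | e.1 == a]%SET
  [set e in E | (e.1 \in Z.1) && (e.2 \in Z.2)]%SET).
congr addn; apply: eq_card => -[a' b]; rewrite !finset.inE /=.
- apply/idP/imsetP => [/andP[/andP[abE _] /eqP aa]|[b' b'N [-> ->]]].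
    by exists b; rewrite -?aa // finset.inE -aa.
  move: (b'N); rewrite finset.inE => ->; rewrite aZ eqxx andbT /=.
  exact: (fintype.subsetP NZ).
- by case: (a' == a); case: (_ \in E).
Qed.

(** In a minimal [F], rows have degree exactly [k]. Columns have degree at least [k], and equality
    follows by comparing sums, the two sides having equal size. *)
Theorem bipartite_factor E : #|A| = #|B| ->
  (forall X Y, (k * (#|X| + #|Y|) <= k * #|A| + edges_between E X Y)%N) ->
  exists F : {set A * B}, [/\ F \subset E,
    forall a, #|[set b | (a, b) \in F]%SET| = k &
    forall b, #|[set a | (a, b) \in F]%SET| = k].
Proof.
move=> AB dE0.
have [F /minsetP[/andP[FE dF] minF] _] :
    {F | minset (fun F : {set A * B} => (F \subset E) && demand F) F & F \subset E}.
  apply: minset_exists; rewrite subxx /=.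
  by apply/forallP => X; apply/forallP => Y.
have minF' e : e \in F -> ~~ demand (F :\ e)%SET.
  move=> eF; apply/negP => dFe.
  have FeF : (F :\ e)%SET = F.
    by apply: minF; rewrite ?subD1set // dFe andbT (fintype.subset_trans _ FE) ?subD1set.
  by move: eF; rewrite -FeF !finset.inE eqxx.
have degA a : #|[set b | (a, b) \in F]%SET| = k.
  apply/eqP; rewrite eqn_leq minimal_demand_deg //=.
  have /forallP/(_ [set a]%SET)/forallP/(_ [set: B]%SET) := dF.
  rewrite cards1 cardsT -AB mulnDr muln1 addnC leq_add2l => /leq_trans; apply.
  rewrite -(card_imset (f := fun b => (a, b))); last by move=> b c [].
  apply/subset_leq_card/fintype.subsetP => -[a' b]; rewrite !finset.inE /=.
  move=> /and3P[abF /eqP aa _]; apply/imsetP; exists b; rewrite ?aa //.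
  by rewrite finset.inE -aa.
have degB b : (k <= #|[set a | (a, b) \in F]%SET|)%N.
  have /forallP/(_ [set: A]%SET)/forallP/(_ [set b]%SET) := dF.
  rewrite cards1 cardsT mulnDr muln1 leq_add2l => /leq_trans; apply.
  rewrite -(card_imset (f := fun a => (a, b))); last by move=> a c [].
  apply/subset_leq_card/fintype.subsetP => -[a b']; rewrite !finset.inE /=.
  move=> /andP[abF /eqP bb]; apply/imsetP; exists a; rewrite ?bb //.
  by rewrite finset.inE -bb.
exists F; split => // b; apply/eqP; rewrite eq_sym.
have sumF : (\sum_(b : B) #|[set a | (a, b) \in F]%SET| = \sum_(b : B) k)%N.
  transitivity (\sum_(a : A) #|[set b | (a, b) \in F]%SET|)%N.
    under eq_bigr do rewrite -sum1dep_card.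
    rewrite (exchange_big_dep predT) //=.
    by under eq_bigr do rewrite sum1dep_card.
  by rewrite (eq_bigr (fun=> k)) // !sum_nat_const AB.
have [_] := @leqif_sum B predT (fun b => k == #|[set a | (a, b) \in F]%SET|)
  (fun=> k) (fun b => #|[set a | (a, b) \in F]%SET|)
  (fun b _ => leqif_eq (degB b)).
by rewrite sumF eqxx => /esym/forallP/(_ b).
Qed.

End BipartiteFactor.


(** Here [x] and [y] are the sizes of two sets, [e] counts the edges between them, and [e1], [e2]
    count those from each set to the complement of the other. With [f = eps - 2 * d], the hypotheses
    give [e >= p * x * (y - M / 2 + f * M)] and its mirror image. *)
Lemma demand_of_density (R : realFieldType) (M x y e e1 e2 p k d eps : R) :
  0 <= x <= M -> 0 <= y <= M -> M <= x + y -> 0 <= p ->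
  0 <= eps - 2 * d <= 2^-1 -> k <= 2 * (eps - 2 * d) * p * M ->
  x * ((2^-1 + eps - d) * p * M) <= e + e1 ->
  y * ((2^-1 + eps - d) * p * M) <= e + e2 ->
  e1 <= p * x * (M - y) + d * p * M * x ->
  e2 <= p * (M - x) * y + d * p * M * y ->
  k * (x + y) <= k * M + e.
Proof.
move=> /andP[x0 xM] /andP[y0 yM] xyM p0 /andP[c0 c1] kle degx degy e1le e2le.
suff : 2 * (eps - 2 * d) * p * M * (x + y - M) <= e.
  have : k * (x + y - M) <= 2 * (eps - 2 * d) * p * M * (x + y - M).
    by rewrite ler_wpM2r // subr_ge0.
  lra.
set f := eps - 2 * d in c0 c1 *.
have ex : p * (x * (y - M / 2 + f * M)) <= e by rewrite /f; lra.
have ey : p * (y * (x - M / 2 + f * M)) <= e by rewrite /f; lra.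
clearbody f; clear degx degy e1le e2le kle.
(* The bound with the smaller size [b] as outer factor suffices: [2 * a >= a + b >= M] makes both
   terms of the identity below nonnegative. *)
have key a b : 0 <= a <= M -> 0 <= b <= M -> M <= a + b -> b <= a ->
    2 * f * M * (a + b - M) <= b * (a - M / 2 + f * M).
  move=> /andP[a0 aM] /andP[b0 bM] abM ba; rewrite -subr_ge0.
  have -> : b * (a - M / 2 + f * M) - 2 * f * M * (a + b - M) =
    2 * f * ((M - a) * (M - b)) + (2^-1 - f) * (b * (2 * a - M)) by field.
  by rewrite addr_ge0 // !mulr_ge0 //; lra.
have mulp : 2 * f * p * M * (x + y - M) = p * (2 * f * M * (x + y - M)) by ring.
rewrite mulp; have [yx|xy] := leP y x.
  by apply: le_trans ey; rewrite ler_wpM2l // key // ?x0 ?y0.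
apply: le_trans ex; rewrite ler_wpM2l // (addrC x y) key //.
- by rewrite y0.
- by rewrite x0.
- by rewrite addrC.
- exact: ltW.
Qed.

(** * Edge distribution of the random hypergraph *)


Definition star (T : finType) (X : {set {set T}}) (Z : {set T}) : {set {set T}} :=
  [set z |: W | W in X, z in Z]%SET.

Definition spread (R : realType) (r n : nat) (p d : R) (K : hypergraph r 'I_n) :=
  forall (X : {set {set 'I_n}}) (Z : {set 'I_n}),
    (forall W, W \in X -> #|W| = (r - 1)%N) ->
    #|hyperedges K :&: star X Z|%SET%:R <=
      p * #|X|%:R * #|Z|%:R + d * p * n%:R * (maxn #|X| #|Z|)%:R.

(** Expanding the product on the right gives a sum over edge sets; those with an edge of the wrong
    size vanish, and the rest are the hypergraphs on the full vertex set. *)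
Lemma hnpr_sum_prod (R : realType) (n r : nat) (p : R) (c : {set 'I_n} -> R) :
  \sum_(K : hypergraph r 'I_n | vertices K == [set: 'I_n]%SET)
     hnpr_weight p K * \prod_(e in hyperedges K) c e =
  \prod_(e : {set 'I_n} | #|e| == r) (p * c e + (1 - p)).
Proof.
pose F (e : {set 'I_n}) : R := if #|e| == r then p * c e else 0.
pose G (e : {set 'I_n}) : R := if #|e| == r then 1 - p else 1.
transitivity (\prod_(e : {set 'I_n}) (F e + G e)); last first.
  rewrite [RHS]big_mkcond; apply: eq_bigr => e _; rewrite /F /G.
  by case: ifP => _ //; rewrite add0r.
rewrite bigA_distr.
rewrite [RHS](bigID (fun J : {set {set 'I_n}} => [forall e in J, #|e| == r])) /=.
rewrite [X in _ = _ + X]big1 ?addr0; last first.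
  move=> J /forallPn[e]; rewrite negb_imply => /andP[eJ er].
  by rewrite (bigD1 e) //= eJ /F (negbTE er) mul0r.
have K0 : hypergraph r 'I_n.
  apply: (@Hypergraph r _ (finset.set0, finset.set0)).
  by apply/forall_inP => e; rewrite inE.
pose h (J : {set {set 'I_n}}) : hypergraph r 'I_n :=
  insubd K0 ([set: 'I_n]%SET, J).
rewrite (reindex_onto h (@hyperedges r _)) /=; last first.
  move=> K /eqP VK; apply: val_inj; rewrite /h insubdK -?VK; last first.
    by case: K {VK} => K HK; exact: HK.
  by rewrite /vertices /hyperedges -surjective_pairing.
apply: eq_big => [J|J].
- apply/idP/idP => [/andP[/eqP VJ /eqP <-]|HJ].
    apply/forall_inP => e eJ.
    by have /forall_inP/(_ e eJ)/andP[] := hg_uniform (h J).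
  rewrite /vertices /hyperedges /h [hg_pair _]insubdK /= ?eqxx //.
  by apply/forall_inP => e eJ; rewrite finset.subsetT (forall_inP HJ).
move=> /andP[_ /eqP EJ]; rewrite /hnpr_weight EJ.
rewrite [X in X * _]big_mkcond [X in _ * X]big_mkcond -big_split.
apply: eq_bigr => e _; rewrite /F /G /=.
have [eJ|eJ] := boolP (e \in J); last by rewrite mulr1.
have [//|er] := eqVneq #|e| r.
move: eJ; rewrite -EJ => eJ.
by have /forall_inP/(_ e eJ)/andP[_] := hg_uniform (h J); rewrite (negbTE er).
Qed.

Lemma hnpr_weight_ge0 (R : realType) (n r : nat) (p : R) (K : hypergraph r 'I_n) :
  0 <= p <= 1 -> 0 <= hnpr_weight p K.
Proof.
move=> /andP[p0 p1]; apply: prodr_ge0 => e _.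
by case: ifP => _ //; rewrite subr_ge0.
Qed.

(** By independence the left side is a product of factors [1 + p * (c e - 1)], each at most
    [expR (p * (c e - 1))]. Members of [A] of the wrong size only enlarge the right side. *)
Lemma hnpr_mgf (R : realType) (n r : nat) (p lam : R) (A : {set {set 'I_n}}) :
  0 <= p <= 1 -> 0 <= lam ->
  \sum_(K : hypergraph r 'I_n | vertices K == [set: 'I_n]%SET)
     hnpr_weight p K * expR (lam * #|hyperedges K :&: A|%SET%:R) <=
  expR (p * #|A|%:R * (expR lam - 1)).
Proof.
move=> /andP[p0 p1] lam0.
pose c e := if e \in A then expR lam else 1 : R.
have c1 e : 1 <= c e by rewrite /c; case: ifP => // _; rewrite -expR0 ler_expR.
rewrite (eq_bigr (fun K => hnpr_weight p K * \prod_(e in hyperedges K) c e)); last first.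
  move=> K _; congr (_ * _); rewrite mulrC expRM_natl -big_mkcondr /= prodr_const.
  by congr (_ ^+ _); apply: eq_card => e; rewrite finset.inE.
rewrite hnpr_sum_prod.
apply: (@le_trans _ _ (\prod_(e : {set 'I_n} | #|e| == r) expR (p * (c e - 1)))).
  apply: ler_prod => e _; apply/andP; split.
    by apply: addr_ge0; [apply: mulr_ge0 => //; apply: le_trans (c1 e) | rewrite subr_ge0].
  by apply: le_trans (expR_ge1Dx _); lra.
rewrite -expR_sum ler_expR.
apply: (@le_trans _ _ (\sum_(e : {set 'I_n}) p * (c e - 1))).
  rewrite [X in X <= _]big_mkcond; apply: ler_sum => e _.
  by case: ifP => // _; rewrite mulr_ge0 // subr_ge0.
rewrite -mulr_sumr -mulrA ler_wpM2l //.
rewrite (bigID (mem A)) /= [X in _ + X]big1 ?addr0; last first.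
  by move=> e /negbTE eA; rewrite /c eA subrr.
rewrite (eq_bigr (fun=> expR lam - 1)); last by move=> e eA; rewrite /c eA.
by rewrite sumr_const mulr_natl.
Qed.

Lemma sum_subset_exprn (R : comRingType) (T : finType) (S : {set T}) (q : R) :
  \sum_(X : {set T} | X \subset S) q ^+ #|X| = (1 + q) ^+ #|S|.
Proof.
rewrite -prodr_const [RHS]big_mkcond /=.
rewrite (eq_bigr (fun i => (if i \in S then q else 0) + 1)); last first.
  move=> i _. case: ifP => _; [exact: addrC | by rewrite add0r].
rewrite bigA_distr [RHS](bigID (fun J : {set T} => J \subset S)) /=.
rewrite [X in _ = _ + X]big1 ?addr0; last first.
  move=> J /fintype.subsetPn[i iJ iS].
  by rewrite (bigD1 i) //= iJ (negbTE iS) mul0r.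
apply: eq_bigr => J JS; rewrite -prodr_const [LHS]big_mkcond /=.
apply: eq_bigr => i _; case: ifP => // iJ.
by rewrite (fintype.subsetP JS i iJ).
Qed.

(** Multiply by [1 - x] and use [expR x * (1 - x) <= 1] together with [(1 + x + 2 * x ^+ 2) * (1 -
    x) = 1 + x ^+ 2 * (1 - 2 * x)]. *)
Lemma expR_quadratic (R : realType) (x : R) : 0 <= x <= 2^-1 ->
  expR x - 1 <= x + 2 * x ^+ 2.
Proof.
move=> /andP[x0 x2].
have h1 : 1 - x <= expR (- x) by apply: expR_ge1Dx.
have h2 := expRxMexpNx_1 x.
have h3 := expR_gt0 x.
have h4 : expR x * (1 - x) <= 1 by rewrite -[X in _ <= X]h2 ler_wpM2l ?expR_ge0.
rewrite -(ler_pM2r (x := 1 - x)); last lra.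
have h5 : 0 <= x ^+ 2 * (1 - 2 * x) by rewrite mulr_ge0 ?sqr_ge0 //; lra.
lra.
Qed.

Lemma card_star (T : finType) (X : {set {set T}}) (Z : {set T}) :
  (#|star X Z| <= #|X| * #|Z|)%N.
Proof. by rewrite /star curry_imset2X -cardsX leq_imset_card. Qed.

(** An exponential Markov bound makes the failure probability at [(X, Z)] at most
    [q ^+ #|X| * q ^+ #|Z|]. Over all pairs except the empty one this sums to
    [(1 + q) ^+ ('C(n, r - 1) + n) - 1]. *)
Lemma spread_probability (R : realType) (r n : nat) (p d : R)
    (A : set (hypergraph r 'I_n)) :
  0 <= p <= 1 -> 0 < d <= 1 ->
  (forall K, spread p d K -> A K) ->
  2 - expR (expR (- (d ^+ 2 / 16 * (p * n%:R))) * ('C(n, r - 1) + n)%:R) <=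
    hnpr_prob p A.
Proof.
move=> p01 /andP[d0 d1] spreadA; have /andP[p0 p1] := p01.
set q := expR (- (d ^+ 2 / 16 * (p * n%:R))).
have q0 : 0 <= q := expR_ge0 _.
(* This value minimises [2 * lam ^+ 2 - lam * d], giving [- d ^+ 2 / 8]; the rate halves to
   [d ^+ 2 / 16] because [#|X| + #|Z|] is at most twice the maximum. *)
pose lam := d / 4.
have lam0 : 0 <= lam by rewrite /lam; lra.
pose S := [set W : {set 'I_n} | #|W| == (r - 1)%N]%SET.
pose P (c : {set {set 'I_n}} * {set 'I_n}) := (c.1 \subset S) && (c.2 \subset [set: 'I_n]%SET).
pose t (c : {set {set 'I_n}} * {set 'I_n}) : R :=
  p * #|c.1|%:R * #|c.2|%:R + d * p * n%:R * (maxn #|c.1| #|c.2|)%:R.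
pose c0 : {set {set 'I_n}} * {set 'I_n} := (finset.set0, finset.set0).
pose f (c : {set {set 'I_n}} * {set 'I_n}) (K : hypergraph r 'I_n) : R :=
  expR (lam * #|hyperedges K :&: star c.1 c.2|%SET%:R - lam * t c).
pose V (K : hypergraph r 'I_n) := vertices K == [set: 'I_n]%SET.
have total : \sum_(K | V K) hnpr_weight p K = 1.
  have := hnpr_probT n r p; rewrite /hnpr_prob.
  by under eq_bigl do rewrite classical_sets.in_setT andbT.
have badK K : K \notin A -> 1 <= \sum_(c | P c && (c != c0)) f c K.
  rewrite notin_setE => nA.
  have /existsNP[X /existsNP[Z /not_implyP[cardX /negP]]] : ~ spread p d K.
    by move=> sp; apply: nA; apply: spreadA.
  rewrite -ltNge => lt.
  (* The empty pair never fails; leaving it out removes the term 1 from the sum. *)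
  have XZ0 : (X, Z) != c0.
    apply: contraTneq lt => -[-> ->]; rewrite -leNgt !cards0 !mulr0 addr0.
    suff -> : star finset.set0 finset.set0 = finset.set0 :> {set {set 'I_n}}.
      by rewrite finset.setI0 cards0.
    by apply/eqP; rewrite -cards_eq0 -leqn0 (leq_trans (card_star _ _)) ?cards0.
  rewrite (bigD1 (X, Z)) /=; last first.
    rewrite XZ0 /P /= finset.subsetT !andbT; apply/fintype.subsetP => W WX.
    by rewrite finset.inE cardX.
  apply: ler_wpDr; first by apply: sumr_ge0 => c _; apply: expR_ge0.
  rewrite -expR0 ler_expR subr_ge0 ler_wpM2l //; exact: ltW.
have fle c : P c -> \sum_(K | V K) hnpr_weight p K * f c K <= q ^+ #|c.1| * q ^+ #|c.2|.
  move=> _.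
  rewrite (eq_bigr (fun K => expR (- (lam * t c)) *
     (hnpr_weight p K * expR (lam * #|hyperedges K :&: star c.1 c.2|%SET%:R)))); last first.
    by move=> K _; rewrite /f expRD mulrA mulrC.
  rewrite -mulr_sumr.
  apply: le_trans (ler_wpM2l (expR_ge0 _) (hnpr_mgf r (star c.1 c.2) p01 lam0)) _.
  rewrite -expRD -!expRM_natr -expRD ler_expR /t.
  have cle : #|c.2|%:R <= n%:R :> R by rewrite ler_nat -[X in (_ <= X)%N]card_ord max_card.
  have minmax : #|c.1|%:R * #|c.2|%:R <= n%:R * (maxn #|c.1| #|c.2|)%:R :> R.
    by rewrite mulrC ler_pM // ler_nat leq_maxl.
  have sumax : #|c.1|%:R + #|c.2|%:R <= 2 * (maxn #|c.1| #|c.2|)%:R :> R.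
    by rewrite -natrD -natrM ler_nat mul2n -addnn leq_add ?leq_maxl ?leq_maxr.
  have starle : #|star c.1 c.2|%:R <= #|c.1|%:R * #|c.2|%:R :> R.
    by rewrite -natrM ler_nat card_star.
  have elam : expR lam - 1 <= lam + 2 * lam ^+ 2.
    by apply: expR_quadratic; rewrite lam0 /lam; lra.
  have elam0 : 0 <= expR lam - 1 by rewrite subr_ge0 -expR0 ler_expR.
  have h1 : p * #|star c.1 c.2|%:R * (expR lam - 1) <=
      p * (#|c.1|%:R * #|c.2|%:R) * (lam + 2 * lam ^+ 2).
    by rewrite ler_pM ?ler_wpM2l ?mulr_ge0.
  have h2 : p * (#|c.1|%:R * #|c.2|%:R) * (2 * lam ^+ 2) <=
      p * (n%:R * (maxn #|c.1| #|c.2|)%:R) * (2 * lam ^+ 2).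
    by apply: ler_wpM2r; [rewrite mulr_ge0 ?sqr_ge0 | rewrite ler_wpM2l].
  have h3 : d ^+ 2 / 16 * (p * n%:R) * (#|c.1|%:R + #|c.2|%:R) <=
     d ^+ 2 / 16 * (p * n%:R) * (2 * (maxn #|c.1| #|c.2|)%:R).
    apply: ler_wpM2l => //; apply: mulr_ge0; last exact: mulr_ge0.
    by rewrite mulr_ge0 ?sqr_ge0 ?invr_ge0.
  move: h1 h2 h3; rewrite /lam; move: (expR (d / 4)) => E.
  move: (#|c.1|%:R : R) (#|c.2|%:R : R) (n%:R : R) ((maxn #|c.1| #|c.2|)%:R : R)
    (#|star c.1 c.2|%:R : R) => x y N w s; lra.
have qsum : \sum_(c | P c) q ^+ #|c.1| * q ^+ #|c.2| = (1 + q) ^+ ('C(n, r - 1) + n).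
  rewrite /P -(pair_big (fun X : {set {set 'I_n}} => X \subset S)
    (fun Z : {set 'I_n} => Z \subset [set: 'I_n]%SET) (fun X Z => q ^+ #|X| * q ^+ #|Z|)) /=.
  under eq_bigr do rewrite -mulr_sumr sum_subset_exprn.
  by rewrite -mulr_suml sum_subset_exprn exprD cardsT card_ord card_draws card_ord.
have badsum : \sum_(K | V K && (K \notin A)) hnpr_weight p K <=
    (1 + q) ^+ ('C(n, r - 1) + n) - 1.
  apply: (@le_trans _ _ (\sum_(K | V K) \sum_(c | P c && (c != c0)) hnpr_weight p K * f c K)).
    rewrite big_mkcondr; apply: ler_sum => K _; rewrite -mulr_sumr.
    case: ifP => [/badK b|_]; first by rewrite ler_peMr // hnpr_weight_ge0.
    by rewrite mulr_ge0 ?hnpr_weight_ge0 // sumr_ge0 // => c _; apply: expR_ge0.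
  rewrite exchange_big /= -qsum [X in _ <= X - 1](bigD1 c0) /=; last by rewrite /P !finset.sub0set.
  rewrite !cards0 !expr0 mulr1 addrC addrK.
  by apply: ler_sum => c /andP[Pc _]; apply: fle.
have : (1 + q) ^+ ('C(n, r - 1) + n) <= expR (q * ('C(n, r - 1) + n)%:R).
  by rewrite expRM_natr lerXn2r ?nnegrE ?expR_ge0 ?addr_ge0 // expR_ge1Dx.
rewrite /hnpr_prob; move: total badsum; rewrite (bigID (fun K => K \in A)) /=.
move: (\sum_(_ | _ && (_ \in _)) _) (\sum_(_ | _ && (_ \notin _)) _) => a b.
lra.
Qed.

(** * From bipartite graphs to hypergraphs *)


Section Selections.
Variables (T : finType) (r M : nat) (v : 'I_r.+2 * 'I_M.+1 -> T).
Variable H : hypergraph r.+2 T.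
Hypothesis v_inj : injective v.
Hypothesis v_onto : v @: [set: 'I_r.+2 * 'I_M.+1]%SET = vertices H.
Implicit Types (f : 'I_r.+2 -> 'I_M.+1) (c : 'I_r.+2) (i j : 'I_M.+1).

(** A transversal of the classes. The successor in ['I_M.+1] provides the modular addition used for
    cyclic shifts. *)
Definition selection f : {set T} := [set v (c, f c) | c : 'I_r.+2]%SET.

Definition upd f c i : 'I_r.+2 -> 'I_M.+1 := fun c' => if c' == c then i else f c'.

Lemma mem_selection f c i : (v (c, i) \in selection f) = (i == f c).
Proof.
apply/imsetP/eqP => [[c' _ /v_inj[-> ->]] //|->].
by exists c.
Qed.

Lemma eq_selection f g : f =1 g -> selection f = selection g.
Proof. by move=> fg; apply: eq_imset => c; rewrite fg. Qed.

(* The row of the bipartite graph indexed by [j] is the (r-1)-set with one vertex in each class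
   other than the last, namely [j] in every class except the first, which gets [s (j + t)]. *)
Definition position (s : {perm 'I_M.+1}) (t : 'I_r.+1) (y : 'I_M.+1 * 'I_M.+1) :=
  upd (upd (fun=> y.1) ord0 (s (y.1 + inord t))) ord_max y.2.

Definition row_graph (s : {perm 'I_M.+1}) (t : 'I_r.+1) :
    {set 'I_M.+1 * 'I_M.+1} :=
  [set y | selection (position s t y) \in hyperedges H]%SET.

(** The last class reveals [b], a middle class [j], and the first class [j + t]. Since [r <= M],
    distinct shifts stay distinct modulo [M.+1]. *)
Lemma position_inj (s : {perm 'I_M.+1}) : (r <= M)%N ->
  injective (fun x : 'I_r.+1 * ('I_M.+1 * 'I_M.+1) =>
    selection (position s x.1 x.2)).
Proof.
move=> rM [t [j b]] [t' [j' b']] /= E.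
have {E} E c : position s t (j, b) c = position s t' (j', b') c.
  by apply/eqP; rewrite -mem_selection -E mem_selection.
have bb : b = b' by have := E ord_max; rewrite /position /upd eqxx.
have /perm_inj jt : s (j + inord t) = s (j' + inord t').
  by have := E ord0; rewrite /position /upd /=.
(* With two classes there is no middle class, but the only shift is then 0. *)
have [r0|r0] := posnP r.
  have tt : t = t' by apply: val_inj; case: t {E jt} => t /=; case: t' => t' /=; lia.
  by move: jt; rewrite tt bb => /addIr ->.
have jj : j = j'.
  have := E (inord 1); rewrite /position /upd.
  have i1 : (inord 1 : 'I_r.+2) = 1%N :> nat by rewrite inordK.
  have -> : (inord 1 == ord_max :> 'I_r.+2) = false.
    by apply/negbTE; rewrite -val_eqE /= i1; lia.
  by have -> : (inord 1 == ord0 :> 'I_r.+2) = false by rewrite -val_eqE /= i1.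
move: jt; rewrite jj bb => /addrI /(congr1 val); rewrite /= !inordK; first last.
- by rewrite ltnS (leq_trans _ rM) // -ltnS.
- by rewrite ltnS (leq_trans _ rM) // -ltnS.
by move=> /val_inj ->.
Qed.

(** By [position_inj] the factors use distinct hyperedges, so degrees add over [t]. A vertex of the
    last class sees one column, one of the first class the row that [s] and the shift assign to it,
    and any other the row of its own index. *)
Lemma factor_of_row_graphs (s : {perm 'I_M.+1}) (k : 'I_r.+1 -> nat)
    (F : 'I_r.+1 -> {set 'I_M.+1 * 'I_M.+1}) : (r <= M)%N ->
  (forall t, F t \subset row_graph s t) ->
  (forall t j, #|[set b | (j, b) \in F t]%SET| = k t) ->
  (forall t b, #|[set j | (j, b) \in F t]%SET| = k t) ->
  exists K : hypergraph r.+2 T, is_factor (\sum_t k t) K H.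
Proof.
move=> rM FE rowF colF.
pose edge (x : 'I_r.+1 * ('I_M.+1 * 'I_M.+1)) := selection (position s x.1 x.2).
pose S := [set x : 'I_r.+1 * ('I_M.+1 * 'I_M.+1) | x.2 \in F x.1]%SET.
pose E := (edge @: S)%SET.
have EH : E \subset hyperedges H.
  apply/fintype.subsetP => _ /imsetP[[t y] + ->]; rewrite finset.inE /= => yF.
  by have := fintype.subsetP (FE t) _ yF; rewrite finset.inE.
have unif : [forall e in (vertices H, E).2, (e \subset (vertices H, E).1) && (#|e| == r.+2)].
  apply/forall_inP => e /= eE; have eH := fintype.subsetP EH _ eE.
  exact: (forall_inP (hg_uniform H) e eH).
exists (Hypergraph unif); split; first by rewrite /subhypergraph /vertices /= subxx.
  by [].
move=> w wV; have /imsetP[[c i] _ ->] : w \in v @: [set: 'I_r.+2 * 'I_M.+1]%SET.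
  by rewrite v_onto.
rewrite /hdeg /hyperedges /=.
transitivity #|(edge @: [set x in S | v (c, i) \in edge x])%SET|.
  apply: eq_card => e; rewrite finset.inE finset.sub1set.
  apply/andP/imsetP => [[/imsetP[x xS ->] ve]|[x]].
    by exists x; rewrite // finset.inE xS.
  rewrite finset.inE => /andP[xS vx] ->; split => //; exact: imset_f.
rewrite card_imset; last exact: position_inj.
rewrite -sum1_card (eq_bigl (fun x : 'I_r.+1 * ('I_M.+1 * 'I_M.+1) => predT x.1 &&
   ((x.2 \in F x.1) && (i == position s x.1 x.2 c)))); last first.
  by move=> x; rewrite !finset.inE mem_selection.
rewrite -(pair_big_dep predT (fun t y => (y \in F t) && (i == position s t y c))
  (fun _ _ => 1%N)) /=.
apply: eq_bigr => t _; rewrite sum1dep_card /position /upd.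
have [_|_] := eqVneq c ord_max.
  rewrite -(colF t i) -(card_imset (f := fun j => (j, i)) [set j | (j, i) \in F t]%SET);
    last by move=> j j' [].
  apply: eq_card => -[j b]; rewrite finset.inE /=.
  apply/andP/imsetP => [[jbF /eqP ib]|[j']]; last by rewrite finset.inE => ? [-> ->].
  by exists j; rewrite ?finset.inE ib.
have [_|_] := eqVneq c ord0.
  pose j0 := (s^-1)%g i - inord t.
  rewrite -(rowF t j0) -(card_imset (f := fun b => (j0, b)) [set b | (j0, b) \in F t]%SET);
    last by move=> j j' [].
  apply: eq_card => -[j b]; rewrite finset.inE /=.
  apply/andP/imsetP => [[jbF /eqP ib]|[b']].
    have jj : j = j0 by rewrite /j0 ib permK addrK.
    by exists b; rewrite ?finset.inE -?jj.
  by rewrite finset.inE => ? [-> ->]; rewrite /j0 subrK permKV.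
rewrite -(rowF t i) -(card_imset (f := fun b => (i, b)) [set b | (i, b) \in F t]%SET);
  last by move=> j j' [].
apply: eq_card => -[j b]; rewrite finset.inE /=.
apply/andP/imsetP => [[jbF /eqP ib]|[b']]; last by rewrite finset.inE => ? [-> ->].
by exists b; rewrite ?finset.inE ib.
Qed.

End Selections.


(** * Codegrees and random labellings *)

Definition neighbours (r : nat) (T : finType) (H : hypergraph r T) (W : {set T}) :
    {set T} :=
  [set u | (u \notin W) && ((u |: W)%SET \in hyperedges H)]%SET.

Lemma min_codegree_le (r : nat) (T : finType) (H : hypergraph r T) (W : {set T}) :
  W \subset vertices H -> #|W| = (r - 1)%N -> (min_codegree H <= hdeg H W)%N.
Proof.
move=> WV cW; rewrite /min_codegree.
have : W \in index_enum {set T} by rewrite mem_index_enum.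
elim: (index_enum _) => [//|W' s IH]; rewrite in_cons big_cons.
case/orP => [/eqP <-|/IH le]; first by rewrite WV cW eqxx geq_minl.
by case: ifP => _ //; apply: leq_trans (geq_minr _ _) le.
Qed.

Lemma hyperedge_sub (r : nat) (T : finType) (H : hypergraph r T) (e : {set T}) :
  e \in hyperedges H -> e \subset vertices H /\ #|e| = r.
Proof. by move=> /(forall_inP (hg_uniform H))/andP[? /eqP]. Qed.

Lemma hdeg_le_neighbours (r : nat) (T : finType) (H : hypergraph r.+1 T)
    (W : {set T}) : #|W| = r -> (hdeg H W <= #|neighbours H W|)%N.
Proof.
move=> cW; apply: leq_trans (leq_imset_card (fun u => u |: W)%SET _).
apply/subset_leq_card/fintype.subsetP => e; rewrite finset.inE => /andP[eH We].
have [_ ce] := hyperedge_sub eH.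
have /eqP/cards1P[u eu] : #|(e :\: W)%SET| = 1%N.
  by rewrite cardsD (finset.setIidPr We) ce cW subSnn.
have uWe : (u |: W)%SET = e.
  by rewrite -[RHS](finset.setID e W) eu (finset.setIidPr We) finset.setUC.
apply/imsetP; exists u => //; rewrite finset.inE uWe eH andbT.
have : u \in (e :\: W)%SET by rewrite eu finset.set11.
by rewrite finset.inE => /andP[].
Qed.

Lemma neighbours_sub (r : nat) (T : finType) (H : hypergraph r T) (W : {set T}) :
  neighbours H W \subset vertices H.
Proof.
apply/fintype.subsetP => u; rewrite finset.inE => /andP[_ /hyperedge_sub[sub _]].
by apply: (fintype.subsetP sub); rewrite setU11.
Qed.

Section Link.
Variables (T : finType) (r M : nat) (v : 'I_r.+2 * 'I_M.+1 -> T).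
Hypothesis v_inj : injective v.

Definition link (f : 'I_r.+2 -> 'I_M.+1) (c : 'I_r.+2) : {set T} :=
  [set v (c', f c') | c' in [set~ c]]%SET.

Lemma card_link f c : #|link f c| = r.+1.
Proof.
by rewrite card_imset ?cardsC1 ?card_ord // => c1 c2 /v_inj[].
Qed.

Lemma link_selection f c i : (v (c, i) |: link f c)%SET = selection v (upd f c i).
Proof.
apply/setP => x; rewrite !finset.inE; apply/orP/imsetP => [[/eqP ->|/imsetP[c']]|[c' _ ->]].
- by exists c; rewrite // /upd eqxx.
- rewrite !finset.inE => cc ->; exists c' => //.
  by rewrite /upd (negbTE cc).
- rewrite /upd; case: (eqVneq c' c) => [->|cc]; first by left; rewrite eqxx.
  by right; apply/imsetP; exists c' => //; rewrite !finset.inE.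
Qed.

End Link.

(** A fixed bijection [g] from labels to vertices is composed with a random permutation. The hits of
    [D (W, c)] are the places of class [c] receiving a neighbour of [W], and their expected number
    is [#|neighbours H W|] divided by the number [r.+2] of classes. *)
Lemma exists_labelling (R : realType) (T : finType) (r M : nat)
    (H : hypergraph r.+2 T) (mu dl : R) :
  #|vertices H| = (r.+2 * M.+1)%N -> 0 < mu -> 0 < dl < 1 ->
  mu * r.+2%:R <= (min_codegree H)%:R ->
  ('C(#|T|, r.+1) * r.+2)%:R * (2 * expR (- (dl ^+ 2 * mu / 8))) < 1 ->
  exists v : 'I_r.+2 * 'I_M.+1 -> T, [/\ injective v,
    v @: [set: 'I_r.+2 * 'I_M.+1]%SET = vertices H &
    forall f c, (1 - dl) * mu <=
      #|[set i | selection v (upd f c i) \in hyperedges H]%SET|%:R].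
Proof.
move=> cV mu0 dl01 muH small.
have eT : #|{: 'I_r.+2 * 'I_M.+1}| = #|vertices H| by rewrite card_prod !card_ord.
pose g (x : 'I_r.+2 * 'I_M.+1) : T := enum_val (cast_ord eT (enum_rank x)).
have g_inj : injective g by move=> x y /enum_val_inj/cast_ord_inj/enum_rank_inj.
have gV x : g x \in vertices H by apply: enum_valP.
have img (v : 'I_r.+2 * 'I_M.+1 -> T) : injective v -> (forall x, v x \in vertices H) ->
    v @: [set: 'I_r.+2 * 'I_M.+1]%SET = vertices H.
  move=> v_inj vV; apply/eqP; rewrite eqEcard card_imset // cardsT eT leqnn andbT.
  by apply/fintype.subsetP => _ /imsetP[x _ ->].
pose ok (W : {set T}) := (W \subset vertices H) && (#|W| == r.+1).
pose J := ({W : {set T} | ok W} * 'I_r.+2)%type.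
pose D (x : J) : {set ('I_r.+2 * 'I_M.+1) * ('I_r.+2 * 'I_M.+1)} :=
  finset.setX [set y | y.1 == x.2]%SET [set y | g y \in neighbours H (val x.1)]%SET.
have class c : #|[set y : 'I_r.+2 * 'I_M.+1 | y.1 == c]%SET| = M.+1.
  have -> : [set y : 'I_r.+2 * 'I_M.+1 | y.1 == c]%SET =
      ((fun i => (c, i)) @: [set: 'I_M.+1])%SET.
    apply/setP => -[c' i]; rewrite finset.inE /=.
    apply/eqP/imsetP => [->|[i' _ [-> _]] //]; exists i => //; exact: finset.in_setT.
  by rewrite card_imset ?cardsT ?card_ord // => i j [].
have gN (N : {set T}) : N \subset vertices H -> #|[set y | g y \in N]%SET| = #|N|.
  move=> NV; rewrite -(card_imset _ g_inj); apply: eq_card => u.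
  apply/imsetP/idP => [[y]|uN]; first by rewrite finset.inE => yN ->.
  have : u \in g @: [set: 'I_r.+2 * 'I_M.+1]%SET by rewrite img // (fintype.subsetP NV).
  by case/imsetP => y _ uy; exists y; rewrite // finset.inE -uy.
have muD x : mu * #|{: 'I_r.+2 * 'I_M.+1}|%:R <= #|D x|%:R.
  case: x => -[W /= okW] c; have /andP[WV /eqP cW] := okW.
  rewrite cardsX class gN ?neighbours_sub //= card_prod !card_ord !natrM mulrA mulrC.
  rewrite ler_wpM2l //; apply: le_trans muH _; rewrite ler_nat.
  apply: leq_trans (hdeg_le_neighbours H cW).
  by apply: min_codegree_le => //; rewrite cW subn1.
have cardJ : (#|{: J}| <= 'C(#|T|, r.+1) * r.+2)%N.
  rewrite card_prod card_ord leq_mul2r card_sig -card_draws.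
  by apply/orP; right; apply/subset_leq_card/fintype.subsetP => W; rewrite !inE => /andP[].
have [] := perm_many_hits mu0 dl01 _ muD.
- by rewrite card_prod !card_ord.
- by apply: le_lt_trans small; rewrite ler_wpM2r ?mulr_ge0 ?expR_ge0 // ler_nat.
move=> s hs; pose v x := g (s x).
have v_inj : injective v by move=> x y /g_inj/perm_inj.
exists v; split => //; first by apply: img => // x; apply: gV.
move=> f c.
have okL : ok (link v f c).
  rewrite /ok card_link // eqxx andbT; apply/fintype.subsetP => _ /imsetP[c' _ ->].
  exact: gV.
(* The link depends on [s], which is harmless because [hs] covers all sets [W] at once. *)
have := hs (exist (fun W => is_true (ok W)) (link v f c) okL, c).
move/le_trans; apply; rewrite ler_nat /hits.
apply: leq_trans (leq_imset_card (fun i => (c, i)) _).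
apply/subset_leq_card/fintype.subsetP => -[c' i].
rewrite !finset.inE /= => /andP[/eqP -> /andP[_ vi]]; apply/imsetP; exists i => //.
by rewrite finset.inE -link_selection.
Qed.


(** A cyclic shift of the rows preserves the density of [D b], so the shifts just enlarge the family
    in the union bound. *)
Lemma exists_shifted_perm (R : realType) (m : nat) (B : finType)
    (D : B -> {set 'I_m.+1 * 'I_m.+1}) (mu dl : R) :
  0 < mu -> 0 < dl < 1 ->
  (forall b j, mu <= #|[set a | (j, a) \in D b]%SET|%:R) ->
  (#|B| * m.+1)%:R * (2 * expR (- (dl ^+ 2 * mu / 8))) < 1 ->
  exists s : {perm 'I_m.+1}, forall b t,
    (1 - dl) * mu <= #|[set j | (j, s (j + t)) \in D b]%SET|%:R.
Proof.
move=> mu0 dl01 degD small.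
pose D' (x : B * 'I_m.+1) := [set y | (y.1 - x.2, y.2) \in D x.1]%SET.
have muD x : mu * #|'I_m.+1|%:R <= #|D' x|%:R.
  case: x => b t.
  rewrite -sum1dep_card (eq_bigl (fun y : 'I_m.+1 * 'I_m.+1 => predT y.1 &&
    ((y.1 - t, y.2) \in D b))) //.
  rewrite -(pair_big_dep predT (fun i a => (i - t, a) \in D b) (fun _ _ => 1%N)) /=.
  rewrite natr_sum mulr_natr -[X in mu *+ X]sum1_card -sumrMnr.
  by apply: ler_sum => i _; rewrite mulr1n sum1dep_card.
have [] := perm_many_hits mu0 dl01 _ muD; first by rewrite card_ord.
  by rewrite card_prod card_ord.
move=> s hs; exists s => b t; have := hs (b, t).
move/le_trans; apply; rewrite ler_nat /hits.
apply: leq_trans (leq_imset_card (fun j => j + t) _).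
apply/subset_leq_card/fintype.subsetP => i; rewrite !finset.inE /= => iD.
by apply/imsetP; exists (i - t); rewrite ?finset.inE subrK.
Qed.

(** * Factors of the row graphs *)

Section RowColumnSums.
Variables (R : realFieldType) (A B : finType) (E : {set A * B}) (del : R).

Lemma edges_between_rows (X : {set A}) (Y : {set B}) :
  (forall a, del <= #|[set b | (a, b) \in E]%SET|%:R) ->
  #|X|%:R * del <= (edges_between E X Y)%:R + (edges_between E X (~: Y)%SET)%:R.
Proof.
move=> deg; rewrite -natrD !edges_betweenE -big_split /=.
rewrite (eq_bigr (fun e : A * B => (e.1 \in X : nat))); last first.
  by move=> e _; rewrite finset.inE; case: (_ \in X); case: (_ \in Y).
rewrite -big_mkcondr /= (eq_bigl (fun e : A * B => (e.1 \in X) && ((e.1, e.2) \in E))); last first.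
  by case=> a b; rewrite andbC.
rewrite -(pair_big_dep (fun a => a \in X) (fun a b => (a, b) \in E) (fun _ _ => 1%N)) /=.
rewrite natr_sum mulr_natl -sumr_const.
by apply: ler_sum => a _; rewrite sum1dep_card.
Qed.

End RowColumnSums.

Lemma edges_between_tr (A B : finType) (E : {set A * B}) (X : {set A}) (Y : {set B}) :
  edges_between [set e : B * A | (e.2, e.1) \in E]%SET Y X = edges_between E X Y.
Proof.
rewrite /edges_between -(card_imset (f := fun e : A * B => (e.2, e.1))); last first.
  by move=> [a b] [a' b'] /= [-> ->].
apply: eq_card => -[b a]; rewrite !finset.inE /=.
apply/andP/imsetP => [[abE /andP[bY aX]]|[[a' b']]].
  by exists (a, b); rewrite // !finset.inE /= abE aX.
by rewrite !finset.inE /= => /andP[abE /andP[aX bY]] [-> ->]; rewrite abE aX bY.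
Qed.

Lemma edges_between_columns (R : realFieldType) (A B : finType) (E : {set A * B})
    (del : R) (X : {set A}) (Y : {set B}) :
  (forall b, del <= #|[set a | (a, b) \in E]%SET|%:R) ->
  #|Y|%:R * del <= (edges_between E X Y)%:R + (edges_between E (~: X)%SET Y)%:R.
Proof.
move=> deg; rewrite -!(edges_between_tr E); apply: edges_between_rows => b.
by have := deg b; congr (_ <= _%:R); apply: eq_card => a; rewrite !finset.inE.
Qed.

(** An edge [(j, b)] stands for the hyperedge joining the link of row [j] to the vertex [b] of the
    last class, which lies in a star; [position_inj] keeps distinct edges distinct. *)
Lemma spread_row_graph (R : realType) (n r M : nat) (G H : hypergraph r.+2 'I_n)
    (p d : R) (v : 'I_r.+2 * 'I_M.+1 -> 'I_n) (s : {perm 'I_M.+1}) (t : 'I_r.+1)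
    (X Y : {set 'I_M.+1}) :
  0 <= p -> 0 <= d -> spread p d G -> hyperedges H \subset hyperedges G ->
  injective v -> (r <= M)%N ->
  (edges_between (row_graph v H s t) X Y)%:R <=
    p * #|X|%:R * #|Y|%:R + d * p * n%:R * (maxn #|X| #|Y|)%:R.
Proof.
move=> p0 d0 spG HG v_inj rM.
pose f (j : 'I_M.+1) : 'I_r.+2 -> 'I_M.+1 := upd (fun=> j) ord0 (s (j + inord t)).
pose X' := [set link v (f j) ord_max | j in X]%SET.
pose Y' := [set v (ord_max, b) | b in Y]%SET.
have cX' : (#|X'| <= #|X|)%N by apply: leq_imset_card.
have cY' : (#|Y'| <= #|Y|)%N by apply: leq_imset_card.
have sz W : W \in X' -> #|W| = (r.+2 - 1)%N.
  by case/imsetP => j _ ->; rewrite card_link // subn1.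
apply: (@le_trans _ _ #|hyperedges G :&: star X' Y'|%SET%:R).
  rewrite ler_nat /edges_between.
  rewrite -(card_imset (f := fun y => selection v (position s t y))); last first.
    by move=> y y' E; have [] := @position_inj _ _ _ _ v_inj s rM (t, y) (t, y') E.
  apply/subset_leq_card/fintype.subsetP => _ /imsetP[[j b] + ->].
  rewrite !finset.inE /= => /andP[yE /andP[jX bY]].
  rewrite (fintype.subsetP HG) //=; apply/imset2P.
  exists (link v (f j) ord_max) (v (ord_max, b)); first exact: imset_f.
    exact: imset_f.
  by rewrite link_selection.
apply: le_trans (spG X' Y' sz) _.
have max0 : (0 : R) <= p * n%:R by rewrite mulr_ge0.
apply: lerD.
  by rewrite -!mulrA ler_wpM2l // -!natrM ler_nat leq_mul.
rewrite ler_wpM2l ?mulr_ge0 // ler_nat geq_max.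
by rewrite !leq_max cX' cY' orbT.
Qed.


Lemma row_graph_factor (R : realType) (n r M : nat) (G H : hypergraph r.+2 'I_n)
    (p d0 d eps : R) (v : 'I_r.+2 * 'I_M.+1 -> 'I_n) (s : {perm 'I_M.+1})
    (t : 'I_r.+1) (k : nat) :
  0 < p -> 0 <= d0 -> 0 < d -> 2 * d <= eps -> d0 * n%:R <= d * M.+1%:R ->
  spread p d0 G -> hyperedges H \subset hyperedges G -> injective v -> (r <= M)%N ->
  (forall j, (2^-1 + eps - d) * p * M.+1%:R <=
     #|[set b | (j, b) \in row_graph v H s t]%SET|%:R) ->
  (forall b, (2^-1 + eps - d) * p * M.+1%:R <=
     #|[set j | (j, b) \in row_graph v H s t]%SET|%:R) ->
  k%:R <= 2 * (eps - 2 * d) * p * M.+1%:R ->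
  exists F : {set 'I_M.+1 * 'I_M.+1}, [/\ F \subset row_graph v H s t,
    forall j, #|[set b | (j, b) \in F]%SET| = k &
    forall b, #|[set j | (j, b) \in F]%SET| = k].
Proof.
move=> p0 d00 dgt0 deps d0n spG HG v_inj rM degr degc kle.
set E := row_graph v H s t in degr degc *.
have M0 : 0 < M.+1%:R :> R by rewrite ltr0n.
have spE (X Y : {set 'I_M.+1}) : (edges_between E X Y)%:R <=
    p * #|X|%:R * #|Y|%:R + d * p * M.+1%:R * (maxn #|X| #|Y|)%:R.
  apply: le_trans (spread_row_graph _ _ _ _ (ltW p0) d00 spG HG v_inj rM) _.
  rewrite lerD2l ler_wpM2r // mulrAC [X in _ <= X]mulrAC.
  by rewrite ler_wpM2r // ltW.
have sz (X : {set 'I_M.+1}) : (#|X| <= M.+1)%N.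
  by rewrite -[X in (_ <= X)%N]card_ord max_card.
have szC (X : {set 'I_M.+1}) : #|(~: X)%SET|%:R = M.+1%:R - #|X|%:R :> R.
  by apply: (canRL (addrK _)); rewrite -natrD addnC cardsC card_ord.
(* Counting all edges by rows and by spreadness gives [2^-1 + eps - d <= 1 + d]. *)
have half : eps - 2 * d <= 2^-1.
  have := edges_between_rows [set: 'I_M.+1]%SET [set: 'I_M.+1]%SET degr.
  rewrite finset.setCT; have := spE [set: 'I_M.+1]%SET [set: 'I_M.+1]%SET.
  have -> : edges_between E [set: 'I_M.+1]%SET finset.set0 = 0%N.
    by rewrite edges_betweenE big1 // => e _; rewrite finset.in_set0 andbF.
  rewrite addr0 !cardsT card_ord maxnn => h1 h2.
  have := le_trans h2 h1.
  rewrite -[p * _ * _]mulrA -(mulrA d) (mulrA d) -mulrA.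
  have -> : M.+1%:R * ((2^-1 + eps - d) * (p * M.+1%:R)) =
    (2^-1 + eps - d) * (p * M.+1%:R * M.+1%:R) :> R by ring.
  have -> : p * (M.+1%:R * M.+1%:R) + d * p * M.+1%:R * M.+1%:R =
    (1 + d) * (p * M.+1%:R * M.+1%:R) :> R by ring.
  rewrite ler_pM2r ?mulr_gt0 //; lra.
apply: bipartite_factor => // X Y; rewrite card_ord.
have [le|gt] := leqP (#|X| + #|Y|) M.+1.
  by apply: leq_trans (leq_addr _ _); rewrite leq_mul2l le orbT.
rewrite -(ler_nat R) natrD !natrM natrD.
have gtR : M.+1%:R <= #|X|%:R + #|Y|%:R :> R by rewrite -natrD ler_nat ltnW.
have cX := cardsC X; have cY := cardsC Y; rewrite !card_ord in cX cY.
apply: (demand_of_density (p := p) (d := d) (eps := eps)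
  (e1 := (edges_between E X (~: Y)%SET)%:R)
  (e2 := (edges_between E (~: X)%SET Y)%:R)) => //.
- by rewrite ler0n ler_nat sz.
- by rewrite ler0n ler_nat sz.
- exact: ltW.
- by rewrite half andbT; lra.
- exact: edges_between_rows.
- exact: edges_between_columns.
(* As [#|X| + #|Y|] exceeds [M.+1], each complement is smaller than the opposite set, which
   therefore determines the error term. *)
- have YX : (#|(~: Y)%SET| <= #|X|)%N.
    by rewrite -(leq_add2l #|Y|) cY addnC ltnW.
  by have := spE X (~: Y)%SET; rewrite (maxn_idPl YX) szC.
- have XY : (#|(~: X)%SET| <= #|Y|)%N by rewrite -(leq_add2l #|X|) cX ltnW.
  by have := spE (~: X)%SET Y; rewrite (maxn_idPr XY) szC.
Qed.

Lemma sum_balanced (L k : nat) :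
  (\sum_(t < L.+1) (k %/ L.+1 + (t < k %% L.+1)) = k)%N.
Proof.
rewrite big_split /= sum_nat_const card_ord [RHS](divn_eq k L.+1) mulnC; congr addn.
rewrite -big_mkcond sum1_card /=.
rewrite -[RHS](card_ord (k %% L.+1)).
have le : (k %% L.+1 <= L.+1)%N by rewrite ltnW ?ltn_mod.
rewrite -(card_imset predT (f := widen_ord le)); last first.
  by move=> i j /(congr1 val) /= /val_inj.
apply: eq_card => i; apply/idP/imsetP => [lt|[j _ ->]]; last exact: (ltn_ord j).
by exists (Ordinal lt) => //; apply: val_inj.
Qed.

(** A relative loss [d / 3] occurs twice, in the labelling and in the shifted permutation. The term
    [r.+1] added to [k] pays for rounding when [k] is split evenly over the shifts. *)
Lemma factor_of_spread (R : realType) (n r M : nat) (G H : hypergraph r.+2 'I_n)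
    (p d0 d eps : R) (k : nat) :
  0 < p -> 0 <= d0 -> 0 < d < 1 -> 2 * d <= eps -> eps < 1 ->
  spread p d0 G -> subhypergraph H G -> #|vertices H| = (r.+2 * M.+1)%N ->
  (r <= M)%N -> d0 * n%:R <= d * M.+1%:R ->
  (2^-1 + eps) * p * #|vertices H|%:R <= (min_codegree H)%:R ->
  (maxn ('C(n, r.+1) * r.+2) (M.+1 * M.+1))%:R *
    (2 * expR (- ((d / 3) ^+ 2 * ((1 - d / 3) * ((2^-1 + eps) * p * M.+1%:R)) / 8))) < 1 ->
  (k + r.+1)%:R <= 2 * (eps - 2 * d) * p * M.+1%:R * r.+1%:R ->
  exists F : hypergraph r.+2 'I_n, is_factor k F H.
Proof.
move=> p0 d00 /andP[dgt0 d1] deps eps1 spG /andP[_ HG] cV rM d0n degH small kle.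
set mu := (2^-1 + eps) * p * M.+1%:R in small.
have M0 : 0 < M.+1%:R :> R by rewrite ltr0n.
have mu0 : 0 < mu by rewrite /mu !mulr_gt0 //; lra.
have dl01 : 0 < d / 3 < 1 by lra.
have mu10 : 0 < (1 - d / 3) * mu by rewrite mulr_gt0 //; lra.
(* [small] is stated for the lower mean [(1 - d / 3) * mu] of the second random choice, so it also
   covers the first. *)
have tail_le : expR (- ((d / 3) ^+ 2 * mu / 8)) <=
    expR (- ((d / 3) ^+ 2 * ((1 - d / 3) * mu) / 8)).
  rewrite ler_expR lerN2 ler_wpM2r ?invr_ge0 // ler_wpM2l ?sqr_ge0 //.
  by rewrite ler_piMl ?ltW //; lra.
have [||v [v_inj v_onto lines]] := @exists_labelling R _ r M H mu (d / 3) cV mu0 dl01.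
- by apply: le_trans degH; rewrite cV /mu natrM -!mulrA ler_wpM2l ?(mulrC M.+1%:R) //; lra.
- apply: le_lt_trans small; rewrite card_ord; apply: ler_pM; rewrite ?mulr_ge0 ?expR_ge0 //.
    by rewrite ler_nat leq_maxl.
  by rewrite ler_wpM2l.
pose D (b : 'I_M.+1) := [set y : 'I_M.+1 * 'I_M.+1 |
  selection v (upd (upd (fun=> y.1) ord0 y.2) ord_max b) \in hyperedges H]%SET.
have degD b j : (1 - d / 3) * mu <= #|[set a | (j, a) \in D b]%SET|%:R.
  apply: le_trans (lines (upd (fun=> j) ord_max b) ord0) _; rewrite ler_nat.
  apply/subset_leq_card/fintype.subsetP => a; rewrite !finset.inE /=.
  suff -> : selection v (upd (upd (fun=> j) ord_max b) ord0 a) =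
    selection v (upd (upd (fun=> j) ord0 a) ord_max b) by [].
  by apply: eq_selection => c; rewrite /upd; case: (eqVneq c ord0) => // ->.
have [|s hs] := exists_shifted_perm mu10 dl01 degD.
  apply: le_lt_trans small; rewrite card_ord ler_wpM2r ?mulr_ge0 ?expR_ge0 //.
  by rewrite ler_nat leq_maxr.
(* As [2^-1 + eps < 3 / 2], the two losses together cost at most [d]. *)
have mu_d : (2^-1 + eps - d) * p * M.+1%:R <= (1 - d / 3) * ((1 - d / 3) * mu).
  have -> : (1 - d / 3) * ((1 - d / 3) * mu) =
    ((1 - d / 3) ^+ 2 * (2^-1 + eps)) * (p * M.+1%:R) by rewrite /mu; ring.
  rewrite -mulrA ler_wpM2r ?mulr_ge0 ?(ltW p0) //.
  have : 0 <= d * (1 - eps) by rewrite mulr_ge0 ?ltW // subr_gt0.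
  have : 0 <= d ^+ 2 * (2^-1 + eps) by rewrite mulr_ge0 ?sqr_ge0 //; lra.
  lra.
pose kt (t : 'I_r.+1) := (k %/ r.+1 + (t < k %% r.+1))%N.
have ktle t : (kt t)%:R <= 2 * (eps - 2 * d) * p * M.+1%:R.
  rewrite -(ler_pM2r (x := r.+1%:R)) ?ltr0n //; apply: le_trans kle.
  rewrite -natrM ler_nat /kt mulnDl leq_add ?leq_trunc_div //.
  by case: (_ < _)%N; rewrite ?mul1n ?mul0n.
have fac t : exists F : {set 'I_M.+1 * 'I_M.+1}, [/\ F \subset row_graph v H s t,
    forall j, #|[set b | (j, b) \in F]%SET| = kt t &
    forall b, #|[set j | (j, b) \in F]%SET| = kt t].
  apply: (row_graph_factor p0 d00 dgt0 deps d0n spG HG v_inj rM _ _ (ktle t)).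
  (* Row degrees follow from the labelling for any [s]; only column degrees use the choice of
     [s]. *)
  - move=> j; apply: le_trans mu_d _.
    apply: (@le_trans _ _ ((1 - d / 3) * mu)); first by rewrite ler_piMl ?ltW //; lra.
    apply: le_trans (lines (upd (fun=> j) ord0 (s (j + inord t))) ord_max) _.
    by rewrite ler_nat; apply/subset_leq_card/fintype.subsetP => b; rewrite !finset.inE.
  - move=> b; apply: le_trans mu_d _; apply: le_trans (hs b (inord t)) _.
    by rewrite ler_nat; apply/subset_leq_card/fintype.subsetP => j; rewrite !finset.inE.
have [F hF] := choice fac.
have := @factor_of_row_graphs _ _ _ v H v_inj v_onto s kt F rM.
rewrite sum_balanced; apply.
- by move=> t; case: (hF t).
- by move=> t j; case: (hF t).
- by move=> t b; case: (hF t).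
Qed.


(** * Choice of constants and passage to the limit *)

Lemma bin_le_expn (n m : nat) : ('C(n, m) <= n ^ m)%N.
Proof.
apply: (@leq_trans (n ^_ m)); first by rewrite -bin_ffact leq_pmulr // fact_gt0.
elim: m n => [|m IH] [|n]; rewrite ?ffactn0 ?expn0 //.
rewrite ffactnS expnS leq_mul2l /=; apply: leq_trans (IH _) _.
by case: m {IH} => // m; rewrite leq_exp2r.
Qed.

Lemma hnpr_prob_le1 (R : realType) (n r : nat) (p : R) (A : set (hypergraph r 'I_n)) :
  0 <= p <= 1 -> hnpr_prob p A <= 1.
Proof.
move=> p01; rewrite -(hnpr_probT n r p) /hnpr_prob.
rewrite big_mkcond [X in _ <= X]big_mkcond; apply: ler_sum => K _.
rewrite classical_sets.in_setT andbT; case: ifP => [/andP[-> _]//|_].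
by case: ifP => // _; apply: hnpr_weight_ge0.
Qed.

Lemma expR_le_powerV (R : realType) (n s : nat) (y : R) : (0 < n)%N ->
  s%:R * ln n%:R <= y -> expR (- y) <= (n%:R ^+ s)^-1.
Proof.
move=> n0 le; have nR : 0 < n%:R :> R by rewrite ltr0n.
rewrite expRN lef_pV2 ?posrE ?expR_gt0 ?exprn_gt0 //.
by rewrite -{1}(lnK (x := n%:R)) ?posrE // -expRM_natl ler_expR.
Qed.

Theorem theorem2 (R : realType) (r : nat) (gamma eps eta : R) :
  (2 <= r)%N -> 0 < gamma < 1 -> 0 < eps < 1 -> 0 < eta < 1 ->
  exists2 C : R, 0 < C &
    forall p : nat -> R,
      (\forall n \near \oo, C * ln n%:R / n%:R < p n < 1) ->
      aas p (fun n => [set G : hypergraph r 'I_n |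
        forall H : hypergraph r 'I_n, subhypergraph H G ->
          let m := #|vertices H| in
          gamma * n%:R <= m%:R ->
          (r %| m)%N ->
          (2^-1 + eps) * p n * m%:R <= (min_codegree H)%:R ->
          forall k : nat, (0 < k)%N -> k%:R <= eps * (1 - eta) * m%:R * p n ->
            exists F : hypergraph r 'I_n, is_factor k F H]).
Proof.
case: r => [//|[//|r]] _ /andP[g0 g1] /andP[e0 e1] /andP[t0 t1].
set s := r.+2.
have s0 : 0 < s%:R :> R by rewrite ltr0n.
have s1 : 1 <= s%:R :> R by rewrite ler1n.
(* Then [2 * (eps - 2 * d)] exceeds [2 * eps * (1 - eta)] by [eps * eta], the room used for
   rounding. *)
pose d := eps * eta / 4.
have et0 : 0 < eps * eta by rewrite mulr_gt0.
have et1 : eps * eta < eps by rewrite gtr_pMr.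
have d0 : 0 < d by rewrite /d; lra.
have d1 : d < 1 by rewrite /d; lra.
have deps : 2 * d <= eps by rewrite /d; lra.
(* Class sizes are at least [gamma * n / s], so a spreadness error [d' * n] is at most
   [d * M.+1]. *)
pose d' := d * gamma / s%:R.
have d'0 : 0 < d' by rewrite /d' divr_gt0 ?mulr_gt0.
have d'1 : d' <= 1.
  rewrite /d' ler_pdivrMr // mul1r; apply: le_trans s1.
  by rewrite mulr_ile1 // ltW.
(* [a1] and [a2] are the exponential rates for spreadness and for the permutations; [a3] serves the
   rounding of [k]. [C] makes the first two exponents at least [s.+1 * ln n], beating union bounds
   of order [n ^ s]. *)
pose a1 := d' ^+ 2 / 16.
pose a2 := d ^+ 2 * gamma / (288 * s%:R).
pose a3 := gamma * (eps * eta) / s%:R.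
have a10 : 0 < a1 by rewrite divr_gt0 ?exprn_gt0.
have a20 : 0 < a2 by rewrite divr_gt0 ?mulr_gt0 ?exprn_gt0.
have a30 : 0 < a3 by rewrite divr_gt0 ?mulr_gt0.
pose C := s.+1%:R / a1 + s.+1%:R / a2 + a3^-1.
have C1 : 0 < s.+1%:R / a1 by rewrite divr_gt0.
have C2 : 0 < s.+1%:R / a2 by rewrite divr_gt0.
have C3 : 0 < a3^-1 by rewrite invr_gt0.
have aC1 : s.+1%:R <= a1 * C.
  by rewrite mulrC -ler_pdivrMr // /C -addrA lerDl addr_ge0 ?ltW.
have aC2 : s.+1%:R <= a2 * C.
  by rewrite mulrC -ler_pdivrMr // /C addrAC lerDr addr_ge0 ?ltW.
have aC3 : 1 <= a3 * C.
  by rewrite mulrC -ler_pdivrMr // div1r /C lerDr addr_ge0 ?ltW.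
exists C; first by rewrite /C !addr_gt0.
move=> p hp; rewrite /aas; apply/cvgrPdist_lt => e egt0; near=> n.
have /andP[pgt plt] : C * ln n%:R / n%:R < p n < 1 by near: n; exact: hp.
have nbig1 : expR 1 <= n%:R :> R by near: n; exact: nbhs_infty_ger.
have nbig2 : 2 * s%:R + 4 < n%:R :> R by near: n; exact: nbhs_infty_gtr.
have nbig3 : s%:R ^+ 2 / gamma <= n%:R :> R by near: n; exact: nbhs_infty_ger.
have nbig4 : 4 / e < n%:R :> R by near: n; exact: nbhs_infty_gtr.
have n0R : 0 < n%:R :> R by lra.
have n0 : (0 < n)%N by rewrite -(ltr0n R).
have ln1 : 1 <= ln n%:R :> R by rewrite -ler_expR lnK ?posrE.
have C0 : 0 < C by rewrite /C !addr_gt0.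
have pn : C * ln n%:R <= p n * n%:R by rewrite -ler_pdivrMr // ltW.
have p0 : 0 < p n.
  by apply: le_lt_trans pgt; rewrite divr_ge0 ?mulr_ge0 ?ltW //; lra.
have p01 : 0 <= p n <= 1 by rewrite !ltW.
have ln0 : 0 <= ln n%:R :> R by lra.
have big a : 0 < a -> s.+1%:R <= a * C -> s.+1%:R * ln n%:R <= a * (p n * n%:R).
  move=> a0 aC; apply: le_trans (ler_wpM2r ln0 aC) _.
  by rewrite -mulrA ler_wpM2l // ltW.
set A := (X in hnpr_prob _ X).
have le1 : hnpr_prob (p n) A <= 1 by apply: hnpr_prob_le1.
suff ge : 1 - 4 / n%:R <= hnpr_prob (p n) A.
  rewrite ger0_norm ?subr_ge0 //.
  have : 4 / n%:R < e by rewrite ltr_pdivrMr // mulrC -ltr_pdivrMr.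
  lra.
have q1 : expR (- (a1 * (p n * n%:R))) <= (n%:R ^+ s.+1)^-1.
  by apply: expR_le_powerV => //; apply: big.
have q2 : expR (- (a2 * (p n * n%:R))) <= (n%:R ^+ s.+1)^-1.
  by apply: expR_le_powerV => //; apply: big.
have powV : n%:R ^+ s * (n%:R ^+ s.+1)^-1 = n%:R^-1 :> R.
  by rewrite exprS invfM mulrCA mulfV ?mulr1 // expf_neq0 // gt_eqF.
(* The inner exponent is at most [x = 2 / n <= 1 / 2], and then [expR x - 1 <= x + 2 * x ^+ 2 <= 2 *
   x = 4 / n]. *)
apply: (@le_trans _ _ (2 - expR (expR (- (d' ^+ 2 / 16 * (p n * n%:R))) * ('C(n, s - 1) + n)%:R))).
  have le2 : expR (- (d' ^+ 2 / 16 * (p n * n%:R))) * ('C(n, s - 1) + n)%:R <= 2 / n%:R.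
    apply: (@le_trans _ _ ((n%:R ^+ s.+1)^-1 * (2 * n%:R ^+ s))).
      apply: ler_pM; rewrite ?expR_ge0 //.
      rewrite -natrX -natrM ler_nat mul2n -addnn leq_add //.
        by apply: leq_trans (bin_le_expn _ _) _; rewrite leq_pexp2l // leq_subr.
      by rewrite -[X in (X <= _)%N]expn1 leq_pexp2l.
    by rewrite mulrC -mulrA powV.
  have n2 : 2 / n%:R <= 2^-1 :> R by rewrite ler_pdivrMr //; lra.
  have n20 : 0 <= 2 / n%:R :> R by rewrite divr_ge0 // ltW.
  have := @expR_quadratic R (2 / n%:R); rewrite n20 n2 => /(_ isT).
  move: le2; rewrite -ler_expR => le2.
  have : (2 / n%:R) ^+ 2 <= 2^-1 * (2 / n%:R) :> R by rewrite expr2 ler_wpM2r.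
  have -> : 4 / n%:R = 2 * (2 / n%:R) :> R by ring.
  move: le2 n20 n2; move: (2 / n%:R : R) => x; lra.
apply: spread_probability => //; first by rewrite d'0.
move=> G spG H HG /=; set m := #|vertices H|; move=> mge dvm degH k k0 kle.
have /dvdnP[M0 mE] := dvm.
have mR : 0 < m%:R :> R by apply: lt_le_trans mge; rewrite mulr_gt0.
case: M0 mE => [|M] mE; first by rewrite mE ltxx in mR.
have mME : m%:R = s%:R * M.+1%:R :> R by rewrite mE natrM mulrC.
have Mge : gamma * n%:R / s%:R <= M.+1%:R by rewrite ler_pdivrMr // (mulrC M.+1%:R) -mME.
have mn : (m <= n)%N by rewrite -[X in (_ <= X)%N]card_ord max_card.
have Mn : (M.+1 <= n)%N by apply: leq_trans mn; rewrite mE leq_pmulr.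
have sM : (s <= M.+1)%N.
  rewrite -(ler_nat R); apply: le_trans Mge; rewrite ler_pdivlMr // -expr2.
  by rewrite mulrC -ler_pdivrMr.
have pM : gamma * (p n * n%:R) / s%:R <= p n * M.+1%:R.
  by rewrite mulrCA -mulrA ler_wpM2l // ltW.
apply: (factor_of_spread (d0 := d') (d := d) (eps := eps) (M := M) p0 (ltW d'0)
  _ deps e1 spG HG) => //.
- by rewrite d0.
- by rewrite -/m mE mulnC.
- by rewrite -ltnS ltnW.
- have -> : d' * n%:R = d * (gamma * n%:R / s%:R) by rewrite /d'; ring.
  by rewrite ler_wpM2l // ltW.
(* Both union bounds range over at most [s * n ^ s] events, so the product is at most
   [2 * s / n < 1]. *)
- apply: (@le_lt_trans _ _ ((s%:R * n%:R ^+ s) * (2 * (n%:R ^+ s.+1)^-1))).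
    apply: ler_pM; rewrite ?mulr_ge0 ?expR_ge0 //.
      rewrite -natrX -natrM ler_nat geq_max; apply/andP; split.
        rewrite mulnC leq_mul2l /=; apply: leq_trans (bin_le_expn _ _) _.
        by rewrite leq_pexp2l.
      apply: (@leq_trans (n ^ 2)); first by rewrite -mulnn leq_mul.
      by apply: (@leq_trans (n ^ s)); rewrite ?leq_pmull // leq_pexp2l.
    rewrite ler_wpM2l //; apply: le_trans q2; rewrite ler_expR lerN2 /a2.
    have h1 : 4^-1 * (gamma * (p n * n%:R) / s%:R) <=
        (1 - d / 3) * ((2^-1 + eps) * p n * M.+1%:R).
      rewrite -[_ * p n * _]mulrA [X in _ <= X]mulrA; apply: ler_pM => //.
        by rewrite divr_ge0 ?mulr_ge0 ?ltW.
      have : 0 <= (1 - d / 3 - 2^-1) * (2^-1 + eps) by rewrite mulr_ge0 //; lra.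
      lra.
    have h2 : 0 <= d ^+ 2 / 72 by rewrite divr_ge0 ?sqr_ge0.
    have := ler_wpM2l h2 h1.
    have -> : d ^+ 2 / 72 * (4^-1 * (gamma * (p n * n%:R) / s%:R)) =
      d ^+ 2 * gamma / (288 * s%:R) * (p n * n%:R) by field; rewrite gt_eqF.
    lra.
  have -> : s%:R * n%:R ^+ s * (2 * (n%:R ^+ s.+1)^-1) = 2 * s%:R / n%:R :> R.
    by rewrite -powV; ring.
  by rewrite ltr_pdivrMr // mul1r; lra.
- have L0 : 1 <= r.+1%:R :> R by rewrite ler1n.
  (* There are [r.+1] shifts for [s = r.+2] classes; this inequality brings the shifts up to the
     full range of [k]. *)
  have sL : s%:R <= 2 * r.+1%:R :> R by rewrite /s -natr1; lra.
  have pM1 : 1 <= eps * eta * (p n * M.+1%:R).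
    have : a3 * (p n * n%:R) <= eps * eta * (p n * M.+1%:R).
      have -> : a3 * (p n * n%:R) = eps * eta * (gamma * (p n * n%:R) / s%:R).
        by rewrite /a3; ring.
      by rewrite ler_wpM2l // ltW.
    apply: le_trans; apply: le_trans (ler_wpM2l (ltW a30) pn).
    by rewrite mulrA; apply: le_trans aC3 _; rewrite ler_peMr // mulr_ge0 ?ltW.
  have h1 : r.+1%:R <= eps * eta * (p n * M.+1%:R) * r.+1%:R by rewrite ler_peMl //; lra.
  have X0 : 0 <= eps * (1 - eta) * (p n * M.+1%:R).
    by rewrite !mulr_ge0 ?ltW ?subr_gt0.
  have h2 := ler_wpM2l X0 sL.
  move: kle; rewrite natrD mME /d; lra.
Unshelve. all: by end_near.
Qed.
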